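(* Let $n$ be a natural number, let $a_1,\dots,a_n$ be natural numbers (positive integers), and let $b$ be a non-negative integer. For $k=1,2,\dots,\sum_{i=1}^{n}a_i-n$ put $$l'_k=\binom{n-1+k}{n-1}-\sum_{i=1}^{n}\overline{C}^{\,n-1}_{n-1+k-a_i}+\sum_{1\le i<j\le n}\overline{C}^{\,n-1}_{n-1+k-a_i-a_j}-\sum_{1\le i<j<m\le n}\overline{C}^{\,n-1}_{n-1+k-a_i-a_j-a_m}+\cdots+(-1)^n\,\overline{C}^{\,n-1}_{n-1+k-\sum_{i=1}^{n}a_i},$$ i.e. $l'_k=\sum_{S\subseteq\{1,\dots,n\}}(-1)^{|S|}\,\overline{C}^{\,n-1}_{n-1+k-\sum_{i\in S}a_i}$. Then $$P(b)=\binom{b+n-1}{n-1}-\sum_{k=1}^{a_1+a_2+\cdots+a_n-n}l'_k\,P(b-k).$$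
   Context: For an integer $l$, $P(l)$ denotes the number of $n$-tuples $(x_1,\dots,x_n)$ of non-negative integers with $\sum_{i=1}^n a_ix_i=l$ (so $P(l)=0$ for $l<0$). For integers $k$ and $m\ge 0$, $\overline{C}^{\,m}_k$ equals the binomial coefficient $\binom{k}{m}$ if $k\ge m$, and $0$ otherwise. Empty sums are $0$. *)

(* Defs.v *)
From mathcomp Require Import all_boot all_order all_algebra.
From mathcomp Require Import finmap classical_sets cardinality.

Set Implicit Arguments.
Unset Strict Implicit.
Unset Printing Implicit Defensive.

Import GRing.Theory Num.Theory.

Local Open Scope ring_scope.

Section Definitions.

Variables (n : nat) (a : 'I_n -> nat).

(* [fset_set] returns the empty set on an infinite set, but the solution set
   is finite as soon as every [a i] is positive. It is empty for [l < 0]. *)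
Definition P (l : int) : nat :=
  #|` fset_set [set x : n.-tuple nat |
        ((\sum_(i < n) a i * tnth x i)%N)%:Z = l]%classic |%fset.

(* [Cbar m k] is $\overline{C}^m_k$: the upper index [m] is the
   lower entry of the binomial coefficient. *)
Definition Cbar (m : nat) (k : int) : nat :=
  if m%:Z <= k then 'C(`|k|, m) else 0%N.

Definition l' (k : nat) : int :=
  \sum_(S : {set 'I_n})
    (-1) ^+ #|S| *
    (Cbar n.-1 (n.-1%:Z + k%:Z - (\sum_(i in S) a i)%N%:Z))%:Z.

End Definitions.

(* Main.v *)
Require Import Defs.
From mathcomp Require Import all_boot all_order all_algebra.
From mathcomp Require Import finmap classical_sets cardinality.

Set Implicit Arguments.
Unset Strict Implicit.
Unset Printing Implicit Defensive.

Import GRing.Theory Num.Theory.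

Local Open Scope ring_scope.

(** The theorem compares coefficients in an identity of generating functions.
    The counts [P a l] have the series [\prod_i 1 / (1 - 'X^(a i))]. Put
    [Q = \prod_i (1 + 'X + ... + 'X^(a i - 1))], a polynomial of degree
    [\sum_i a i - n] with constant term 1. As
    [1 - 'X^(a i) = (1 - 'X) (1 + 'X + ... + 'X^(a i - 1))], multiplying the
    series by [Q] leaves [1 / (1 - 'X)^n], whose coefficients are the binomials
    [C(l + n - 1, n - 1)]. On the other hand
    [Q = \prod_i (1 - 'X^(a i)) / (1 - 'X)^n], and expanding the product over
    the subsets of the indices shows that the coefficients of [Q] are the
    numbers [l' a k]. Comparing coefficients of degree [b] and isolating the
    term [k = 0] gives the recurrence.

    Everything is done with polynomials, each series being truncated beyond the
    degree of interest: [1 / (1 - 'X)] becomes [geom R N] and [1 / (1 - 'X^c)]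
    becomes [\sum_(j < N) 'X^(c * j)]. The product of [Q] with the truncated
    series is then exactly a product of truncations of [1 / (1 - 'X)]
    ([geomM]). The carrying lemmas are [coef_prod_parts] (the counts [P]),
    [coef_prod_geom] (the binomials), [coef_prod_geom_l'] (the numbers [l']) and
    [conv_l'_P] (the resulting convolution identity). *)

(** Congruence modulo ['X^N], stated on coefficients because every product here
    is taken only to read off one coefficient of it. *)
Definition eqXn (R : nzRingType) (N : nat) (p q : {poly R}) : Prop :=
  forall l, (l < N)%N -> p`_l = q`_l.

Lemma eqXnM (R : nzRingType) (N : nat) (p p' q q' : {poly R}) :
  eqXn N p p' -> eqXn N q q' -> eqXn N (p * q) (p' * q').
Proof.
move=> pp' qq' l ltlN; rewrite !coefM; apply: eq_bigr => j _.
rewrite pp' ?qq' //; last by rewrite (leq_ltn_trans _ ltlN) // -ltnS.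
by rewrite (leq_ltn_trans (leq_subr _ _)).
Qed.

Lemma eqXn_prod (R : comNzRingType) (N n : nat) (p q : 'I_n -> {poly R}) :
  (forall i, eqXn N (p i) (q i)) -> eqXn N (\prod_i p i) (\prod_i q i).
Proof.
by move=> pq; apply: (big_rec2 (eqXn N)) => // i x y _; apply: eqXnM.
Qed.

Lemma eqXnX (R : nzRingType) (N m : nat) (p q : {poly R}) :
  eqXn N p q -> eqXn N (p ^+ m) (q ^+ m).
Proof. by move=> pq; elim: m => // m IHm; rewrite !exprS; apply: eqXnM. Qed.

Definition geom (R : nzRingType) (M : nat) : {poly R} := \poly_(j < M) 1.

Lemma geomE (R : nzRingType) (M : nat) : geom R M = \sum_(j < M) 'X^j.
Proof. by rewrite /geom poly_def; apply: eq_bigr => j _; rewrite scale1r. Qed.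

Lemma coef_geom (R : nzRingType) (M l : nat) : (geom R M)`_l = (l < M)%:R.
Proof. by rewrite coef_poly; case: ltnP. Qed.

Lemma size_geom (R : nzRingType) (M : nat) : size (geom R M) = M.
Proof.
case: M => [|M]; first by rewrite geomE big_ord0 size_poly0.
by rewrite size_poly_eq ?oner_neq0.
Qed.

(** The truncated form of [(1 / (1 - 'X)) * (1 - 'X) = 1]. *)
Lemma geom_sub (R : comNzRingType) (c : nat) :
  geom R c * (1 - 'X) = 1 - 'X^c.
Proof. by rewrite -opprB mulrN mulrC geomE -subrX1 opprB. Qed.

(** Every exponent below [c * N] is uniquely [c * j + r] with [r < c]: the
    truncated form of [(1 - 'X^c) / (1 - 'X) * (1 / (1 - 'X^c)) = 1 / (1 - 'X)],
    which holds on the nose. It is checked after multiplying by [1 - 'X]. *)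
Lemma geomM (R : idomainType) (c N : nat) :
  geom R c * \sum_(j < N) 'X^(c * j) = geom R (c * N).
Proof.
apply: (@mulIf _ (1 - 'X)).
  by rewrite -opprB oppr_eq0 -[1]/(1%:P) polyXsubC_eq0.
rewrite mulrAC !geom_sub exprM -opprB mulNr.
under eq_bigr do rewrite exprM.
by rewrite -subrX1 opprB.
Qed.

(** Induction on the exponent: multiplying by [geom R N] takes partial sums of
    the coefficients of degree below [N], and partial sums of binomials are
    again binomials by Pascal's rule (the hockey-stick identity). *)
Lemma coef_geom_exp (R : comNzRingType) (N n l : nat) : (l < N)%N ->
  (geom R N ^+ n.+1)`_l = 'C(l + n, n)%:R.
Proof.
elim: n l => [|n IHn] l ltlN; first by rewrite expr1 coef_geom ltlN bin0.
rewrite exprSr coefM (eq_bigr (fun j : 'I_l.+1 => 'C(j + n, n)%:R)); last first.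
  move=> j _; rewrite IHn; last by rewrite (leq_ltn_trans _ ltlN) // -ltnS.
  by rewrite coef_geom (leq_ltn_trans (leq_subr _ _)) ?mulr1.
rewrite -natr_sum; congr _%:R.
elim: l {ltlN} => [|l IHl]; first by rewrite big_ord1 !add0n !binn.
by rewrite big_ord_recr IHl /= [in RHS]addSn binS addnS -addSn.
Qed.

(** The truncation bounds [M i] may differ, because only coefficients of degree
    at most [l] contribute, and there all the [geom R (M i)] agree. *)
Lemma coef_prod_geom (R : comNzRingType) (n : nat) (M : 'I_n -> nat)
    (l : nat) :
  (0 < n)%N -> (forall i, (l < M i)%N) ->
  (\prod_i geom R (M i))`_l = 'C(l + n.-1, n.-1)%:R.
Proof.
case: n M => // n M _ ltlM.
have /eqXn_prod-> // : forall i, eqXn l.+1 (geom R (M i)) (geom R l.+1).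
  by move=> i k ltkl; rewrite !coef_geom ltkl (leq_trans ltkl).
by rewrite prodr_const card_ord coef_geom_exp.
Qed.

Lemma P_neg (n : nat) (a : 'I_n -> nat) (l : int) : l < 0 -> P a l = 0%N.
Proof.
move=> l_lt0; rewrite /P (_ : mkset _ = set0) ?fset_set0 ?cardfs0 //.
by apply/seteqP; split=> x //= xl; move: l_lt0; rewrite -xl.
Qed.

(** Since each [a i] is positive, a solution has all its entries at most [l],
    so that solutions are finite functions with values in ['I_N]. This is also
    what makes the solution set finite, hence [P] the intended count. *)
Lemma P_card (n : nat) (a : 'I_n -> nat) (N l : nat) :
  (forall i, (0 < a i)%N) -> (l < N)%N ->
  P a l = #|[set f : {ffun 'I_n -> 'I_N} | \sum_i a i * f i == l]%N|.
Proof.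
move=> a_gt0 ltlN; set S := [set f | _].
pose g (f : {ffun 'I_n -> 'I_N}) := [tuple (f i : nat) | i < n].
have g_inj : injective g.
  move=> f1 f2 /(congr1 (fun t => tnth t)) eq_g; apply/ffunP => i.
  by apply/val_inj; have := congr1 (@^~ i) eq_g; rewrite !tnth_mktuple.
rewrite /P (_ : mkset _ = [set` [fset g f | f in S]%fset]%classic).
  rewrite set_fsetK card_imfset // cardE.
  by apply/perm_size/uniq_perm; rewrite ?enum_finmem_uniq ?enum_uniq //.
apply/seteqP; split=> x /=.
  move=> [sol]; apply/imfsetP => /=.
  have ltxN i : (tnth x i < N)%N.
    apply: leq_ltn_trans ltlN; rewrite -sol (bigD1 i) //=.
    by rewrite (leq_trans (leq_pmull _ (a_gt0 i))) ?leq_addr.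
  exists [ffun i => Ordinal (ltxN i)].
    by rewrite inE -sol; apply/eqP/eq_bigr => i _; rewrite ffunE.
  by apply: eq_from_tnth => i; rewrite tnth_mktuple ffunE.
case/imfsetP => f /=; rewrite inE => /eqP <- ->; congr (Posz _).
by apply: eq_bigr => i _; rewrite tnth_mktuple.
Qed.

(** Distributing the product over the sums gives one monomial for each choice of
    the multiplicities [f i < N], of degree [\sum_i a i * f i]. *)
Lemma coef_prod_parts (R : comNzRingType) (n : nat) (a : 'I_n -> nat)
    (N l : nat) :
  (forall i, (0 < a i)%N) -> (l < N)%N ->
  (\prod_i \sum_(j < N) 'X^(a i * j) : {poly R})`_l = (P a l)%:R.
Proof.
move=> a_gt0 ltlN; rewrite (P_card a_gt0 ltlN) bigA_distr_bigA coef_sum.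
rewrite -sum1_card natr_sum [RHS]big_mkcond /=; apply: eq_bigr => f _.
by rewrite prodrXr coefXn inE eq_sym; case: eqP.
Qed.

Lemma prod_subXn (R : comNzRingType) (n : nat) (a : 'I_n -> nat) :
  \prod_i (1 - 'X^(a i)) =
  \sum_(S : {set 'I_n}) (-1) ^+ #|S| *: 'X^(\sum_(i in S) a i) :> {poly R}.
Proof.
under eq_bigr do rewrite addrC.
rewrite bigA_distr; apply: eq_big => // S _.
rewrite -big_mkcond /= prodrN prodrXr -signr_odd.
by rewrite -[in RHS]signr_odd scaler_sign mulr_sign.
Qed.

(** With [k < N], the factor [1 / (1 - 'X)^n] is [geom int N ^+ n] up to degree
    [k], and its product with [\prod_i (1 - 'X^(a i))] is
    [(1 - 'X^N)^n * \prod_i geom int (a i)], which agrees with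
    [\prod_i geom int (a i)] up to degree [k]. *)
Lemma coef_prod_geom_l' (n : nat) (a : 'I_n -> nat) (k : nat) : (0 < n)%N ->
  (\prod_i geom int (a i))`_k = l' a k.
Proof.
case: n a => // n a _.
pose N := k.+1; set Q := \prod_i _.
have QE : geom int N ^+ n.+1 * \prod_i (1 - 'X^(a i)) = (1 - 'X^N) ^+ n.+1 * Q.
  under eq_bigr do rewrite -geom_sub.
  by rewrite big_split /= prodr_const card_ord mulrA mulrAC -exprMn geom_sub.
have one_subXN : eqXn N ((1 - 'X^N) ^+ n.+1) (1 : {poly int}).
  rewrite -[1 in X in eqXn _ _ X](expr1n _ n.+1); apply: eqXnX => l ltlN.
  by rewrite coefB coefXn (ltn_eqF ltlN) subr0.
have -> : Q`_k = (geom int N ^+ n.+1 * \prod_i (1 - 'X^(a i)))`_k.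
  by rewrite QE -[in LHS](mul1r Q); apply/esym/(eqXnM one_subXN).
rewrite prod_subXn mulr_sumr coef_sum; apply: eq_bigr => S _.
(* [Cbar] vanishes exactly when the sum over [S] exceeds [k], that is when
   multiplying by the monomial pushes the series beyond degree [k]. *)
rewrite -scalerAr coefZ coefMXn /Cbar /=; congr (_ * _).
case: ltnP => [ltkS|leSk].
  by rewrite ifF // -addrA lerDl subr_ge0 lez_nat leqNgt ltkS.
rewrite -addrA lerDl subr_ge0 lez_nat leSk subzn // -PoszD absz_nat.
by rewrite coef_geom_exp ?ltnS ?leq_subr // addnC natz.
Qed.

Lemma size_prod_geom (R : idomainType) (n : nat) (a : 'I_n -> nat) :
  (forall i, (0 < a i)%N) ->
  size (\prod_i geom R (a i)) = ((\sum_i a i) - n).+1.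
Proof.
move=> a_gt0; have le_n : (n <= \sum_i a i)%N.
  by rewrite -[leqLHS]card_ord -sum1_card leq_sum.
rewrite size_prod => [|i _]; last by rewrite -size_poly_gt0 size_geom.
by under eq_bigr do rewrite size_geom; rewrite card_ord subSn.
Qed.

Lemma l'0 (n : nat) (a : 'I_n -> nat) : (0 < n)%N ->
  (forall i, (0 < a i)%N) -> l' a 0 = 1.
Proof.
move=> n_gt0 a_gt0; rewrite -coef_prod_geom_l' // -horner_coef0 horner_prod.
by apply: big1 => i _; rewrite horner_coef0 coef_geom a_gt0.
Qed.

(** The Cauchy product behind the recurrence: coefficient of degree [b] in
    [Q * \prod_i 1 / (1 - 'X^(a i)) = 1 / (1 - 'X)^n]. *)
Lemma conv_l'_P (n : nat) (a : 'I_n -> nat) (b : nat) : (0 < n)%N ->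
  (forall i, (0 < a i)%N) ->
  \sum_(0 <= k < b.+1) l' a k * (P a (b%:Z - k%:Z))%:Z =
  'C(b + n.-1, n.-1)%:Z.
Proof.
move=> n_gt0 a_gt0.
(* Truncating at [N = b.+1] turns the factor of index [i] into
   [geom int (a i * N)] by [geomM]. *)
have ltba i : (b < a i * b.+1)%N by rewrite leq_pmull.
rewrite -[RHS]natz -(coef_prod_geom int n_gt0 ltba).
under [in RHS]eq_bigr do rewrite -geomM.
rewrite big_split /= coefM big_mkord; apply: eq_bigr => k _.
have lekb : (k <= b)%N by rewrite -ltnS.
rewrite coef_prod_geom_l' // coef_prod_parts ?ltnS ?leq_subr // natz.
by rewrite subzn.
Qed.

Theorem corollary4p2 (n : nat) (a : 'I_n -> nat) (b : nat)
    (hn : (0 < n)%N) (ha : forall i : 'I_n, (0 < a i)%N) :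
  (P a b%:Z)%:Z =
    'C(b + n.-1, n.-1)%:Z
    - \sum_(1 <= k < ((\sum_(i < n) a i) - n).+1)
        l' a k * (P a (b%:Z - k%:Z))%:Z.
Proof.
set d := (_ - n)%N; pose t k := l' a k * (P a (b%:Z - k%:Z))%:Z.
have l'_large k : (d < k)%N -> l' a k = 0.
  by move=> ltdk; rewrite -coef_prod_geom_l' // nth_default ?size_prod_geom.
(* The two ranges, [k <= b] and [k <= d], are compared through their maximum:
   beyond [d] the factor [l'] vanishes, beyond [b] the factor [P] does. *)
have t_widen m N : (forall k, (m < k)%N -> t k = 0) -> (m <= N)%N ->
    \sum_(0 <= k < N.+1) t k = \sum_(0 <= k < m.+1) t k.
  move=> t0 lemN; rewrite (@big_cat_nat _ _ _ m.+1) //= [X in _ + X]big_nat.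
  by rewrite [X in _ + X]big1 ?addr0 // => k /andP[/t0].
have sum_d : \sum_(0 <= k < d.+1) t k = 'C(b + n.-1, n.-1)%:Z.
  rewrite -(conv_l'_P b hn ha) -(t_widen d (maxn d b)) ?leq_maxl //.
    apply: t_widen; rewrite ?leq_maxr // => k ltbk.
    by rewrite /t P_neg ?mulr0 // subr_lt0 ltz_nat.
  by move=> k /l'_large; rewrite /t => ->; rewrite mul0r.
by rewrite -sum_d big_ltn // /t l'0 // subr0 mul1r addrK.
Qed.
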